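(* Consider the Cauchy problem $$u_t+u=\Gamma(u),\quad t\ge0,\qquad u|_{t=0}=u_0,$$ in $B$ with $\|u_0\|\le1$, and assume that the operator $\Gamma:B\to B$ (a) maps the closed unit ball $U\subset B$ into itself, and (b) satisfies the $L$-Lipschitz condition $$|\Gamma(u_1)-\Gamma(u_2)|\le L(|u_1-u_2|)\quad\text{pointwise, for all }u_1,u_2\in U,$$ for some positive bounded linear operator $L:B\to B$. Then: (i) there exists a unique solution $u(t)$ of the Cauchy problem such that $\|u(t)\|\le1$ for all $t\ge0$; (ii) any two such solutions $u(t)$ and $w(t)$ with initial data $u_0,w_0\in U$ satisfy, pointwise and for all $t\ge 0$, $$|u(t)-w(t)|\le\exp\{t(L-1)\}\,(|u_0-w_0|).$$
   Context: $B=C(X)$ is the Banach space of bounded continuous real-valued functions on $X$ with the sup norm $\|\cdot\|$, where $X=\mathbb{R}_+=[0,\infty)$ (or $X=\mathbb{R}^d$); $U=\{u\in B:\|u\|\le1\}$. $L$ positive means $Lf\ge0$ whenever $f\ge0$. A solution is a continuously differentiable map $t\mapsto u(t)\in B$, $t\ge0$, satisfying the equation and the initial condition (equivalently, a continuous solution of $u(t)=u_0e^{-t}+\int_0^t e^{-(t-\tau)}\Gamma[u(\tau)]\,d\tau$). By definition $\exp\{t(L-1)\}f=e^{-t}\sum_{n=0}^\infty\frac{t^n}{n!}L^nf$. *)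

(* Defs.v *)
From HB Require Import structures.
From mathcomp Require Import all_boot all_order all_algebra.
From mathcomp Require Import all_classical all_reals all_analysis.
From mathcomp Require Import lra.

Set Implicit Arguments.
Unset Strict Implicit.
Unset Printing Implicit Defensive.

Import Order.TTheory GRing.Theory Num.Theory.
Import numFieldNormedType.Exports.

Local Open Scope classical_set_scope.
Local Open Scope ring_scope.

Section BoundedContinuous.
Context {R : realType} {X : topologicalType}.

Definition bounded_continuous : {pred X -> R} :=
  fun f => `[< continuous f /\ exists M, forall x, `|f x| <= M >].

Lemma bounded_continuousP (f : X -> R) :
  reflect (continuous f /\ exists M, forall x, `|f x| <= M)
          (f \in bounded_continuous).
Proof. exact: asboolP. Qed.

Lemma bounded_continuous_submod : submod_closed bounded_continuous.
Proof.
split=> [|a f g].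
  apply/bounded_continuousP; split; first exact: cst_continuous.
  by exists 0 => x; rewrite normr0.
move=> /bounded_continuousP[cf [M fM]] /bounded_continuousP[cg [N gN]].
apply/bounded_continuousP; split.
  move=> x; apply: cvgD; last exact: cg.
  by apply: cvgZl_tmp; exact: cf.
exists (`|a| * M + N) => x; apply: (le_trans (ler_normD _ _)).
by rewrite lerD// normrM ler_wpM2l.
Qed.

HB.instance Definition _ :=
  GRing.isSubmodClosed.Build _ _ bounded_continuous bounded_continuous_submod.

End BoundedContinuous.

Record bcfun (R : realType) (X : topologicalType) := BCFun {
  bcfun_val :> X -> R ;
  bcfun_valP : bcfun_val \in bounded_continuous }.

Section BCFunNormed.
Context {R : realType} {X : topologicalType}.
Local Notation B := (bcfun R X).

HB.instance Definition _ := [isSub for @bcfun_val R X].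
HB.instance Definition _ := [Choice of B by <:].
HB.instance Definition _ := [SubChoice_isSubLmodule of B by <:].

Lemma bcfunP (f g : B) : (forall x, f x = g x) -> f = g.
Proof. by move=> fg; apply/val_inj/funext. Qed.

Lemma bcfunB (f g : B) x : (f - g) x = f x - g x.
Proof. by []. Qed.

Lemma bcfun_continuous (f : B) : continuous f.
Proof. by have /bounded_continuousP[] := bcfun_valP f. Qed.

Definition sup_norm (f : B) : R := sup (range (fun x => `|f x|)).

Lemma bcfun_bounded (f : B) : has_ubound (range (fun x => `|f x|)).
Proof.
have /bounded_continuousP[_ [M fM]] := bcfun_valP f.
by exists M => _ [x _ <-].
Qed.

Lemma le_sup_norm (f : B) x : `|f x| <= sup_norm f.
Proof. by apply: ub_le_sup; [exact: bcfun_bounded|exists x]. Qed.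

Lemma sup_norm_empty (f : B) : ~ ([set: X] !=set0) -> sup_norm f = 0.
Proof.
move=> X0; rewrite /sup_norm.
suff -> : range (fun x => `|f x|) = set0 by rewrite sup0.
by apply/seteqP; split=> // y [x _ _]; apply: X0; exists x.
Qed.

Lemma sup_norm_ge0 (f : B) : 0 <= sup_norm f.
Proof.
have [[x _]|X0] := pselect ([set: X] !=set0).
  by rewrite (le_trans _ (le_sup_norm f x)).
by rewrite sup_norm_empty.
Qed.

Lemma sup_norm_le (f : B) M : 0 <= M -> (forall x, `|f x| <= M) ->
  sup_norm f <= M.
Proof.
move=> M0 fM; have [[x _]|X0] := pselect ([set: X] !=set0).
  by apply: ge_sup => [|_ [y _ <-]//]; exists `|f x|, x.
by rewrite sup_norm_empty.
Qed.

Lemma sup_normD (f g : B) : sup_norm (f + g) <= sup_norm f + sup_norm g.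
Proof.
apply: sup_norm_le => [|x]; first by rewrite addr_ge0 ?sup_norm_ge0.
by rewrite (le_trans (ler_normD _ _))// lerD ?le_sup_norm.
Qed.

Lemma sup_normZ (a : R) (f : B) : sup_norm (a *: f) = `|a| * sup_norm f.
Proof.
have le b (g : B) : sup_norm (b *: g) <= `|b| * sup_norm g.
  apply: sup_norm_le => [|x]; first by rewrite mulr_ge0 ?sup_norm_ge0.
  by rewrite normrM ler_wpM2l ?le_sup_norm.
have [->|a0] := eqVneq a 0.
  apply/eqP; rewrite eq_le le normr0 mul0r.
  exact: sup_norm_ge0.
apply/eqP; rewrite eq_le le/=.
rewrite -{1}[f](scalerK a0) -ler_pdivlMl ?normr_gt0//.
by rewrite -normfV le.
Qed.

Lemma sup_norm_eq0 (f : B) : sup_norm f = 0 -> f = 0.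
Proof.
move=> f0; apply: bcfunP => x; apply/eqP; rewrite -normr_le0 -f0.
exact: le_sup_norm.
Qed.

HB.instance Definition _ :=
  @Lmodule_isNormed.Build R B sup_norm sup_normD sup_normZ sup_norm_eq0.

Lemma bcfun_normE (f : B) : `|f| = sup (range (fun x => `|f x|)).
Proof. by []. Qed.

Lemma bcfun_complete (F : set_system B) :
  ProperFilter F -> cauchy F -> cvg F.
Proof.
move=> FF Fc.
have {}Fc (e : R) : 0 < e -> exists f : B, F [set g | `|f - g| < e].
  move=> e0; have [f Ff] := (cauchyP F).1 Fc e e0.
  by exists f; rewrite -ball_normE in Ff.
have evc x : cvg ((f : B) x @[f --> F]).
  apply: R_complete; apply: cauchy_exP => e e0.
  have [f Ff] := Fc e e0; exists (f x); rewrite /= /nbhs/=.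
  near=> g; rewrite -ball_normE/=.
  apply: (@le_lt_trans _ _ `|f - g|); last by near: g.
  exact: (le_sup_norm (f - g)).
pose l x : R := lim ((f : B) x @[f --> F]).
have lF (e : R) : 0 < e -> \forall f \near F, forall x, `|l x - (f : B) x| <= e.
  move=> e0; have e30 : 0 < e / 3 by rewrite divr_gt0.
  have [f Ff] := Fc _ e30; near=> g => x.
  have fg : `|f - g| < e / 3 by near: g.
  have lx : \forall h \near F, `|l x - (h : B) x| <= e / 3.
    by move: (evc x) => /cvgrPdist_le; exact.
  near F => h.
  have fh : `|f - h| < e / 3 by near: h.
  have lh : `|l x - h x| <= e / 3 by near: h.
  have := le_sup_norm (f - g) x; have := le_sup_norm (f - h) x.
  rewrite !bcfunB => /le_lt_trans/(_ fh) + /le_lt_trans/(_ fg).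
  by move: lh; rewrite !ler_norml !ltr_norml; lra.
have lbc : l \in @bounded_continuous R X.
  apply/bounded_continuousP; split=> [x|].
    apply/cvgrPdist_le => e e0; have e30 : 0 < e / 3 by rewrite divr_gt0.
    near F => f; have fl : forall y, `|l y - f y| <= e / 3.
      by near: f; exact: lF.
    have fx : \forall y \near x, `|f x - f y| <= e / 3.
      by move/cvgrPdist_le : (@bcfun_continuous f x); exact.
    near=> y; have fxy : `|f x - f y| <= e / 3 by near: y.
    by move: (fl x) (fl y) fxy; rewrite !ler_norml; lra.
  near F => f; have fl : forall y, `|l y - f y| <= 1.
    by near: f; exact: lF.
  exists (1 + sup_norm f) => x; have := le_sup_norm f x.
  by move: (fl x); rewrite !ler_norml; lra.
apply/cvg_ex; exists (BCFun lbc); apply/cvgrPdist_le => e e0.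
near=> f; apply: sup_norm_le => [|x]; first exact: ltW.
by move: x; near: f; exact: lF.
Unshelve. all: by end_near. Qed.

HB.instance Definition _ := Uniform_isComplete.Build B bcfun_complete.

Lemma bcabs_subproof (f : B) :
  (fun x => `|f x|) \in @bounded_continuous R X.
Proof.
apply/bounded_continuousP; split=> [x|].
  by apply: cvg_norm; exact: bcfun_continuous.
by exists (sup_norm f) => x; rewrite normr_id le_sup_norm.
Qed.

Definition bcabs (f : B) : B := BCFun (bcabs_subproof f).

End BCFunNormed.

Variant domain_kind := HalfLine | Euclidean of nat.

Definition spatial_domain (R : realType) (D : domain_kind) : topologicalType :=
  match D with
  | HalfLine => set_type ([set x | 0 <= x] : set R)
  | Euclidean d => 'rV[R]_d
  end.

Section CauchyProblem.
Context {R : realType} {B : normedModType R}.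

Definition closed_unit_ball : set B := [set f | `|f| <= 1].

Definition bounded_op (L : B -> B) :=
  exists M : R, forall f, `|L f| <= M * `|f|.

(* exp {t (L - 1)} f = e^-t \sum_n t^n / n! L^n f, as a norm limit *)
Definition op_exp (L : B -> B) (t : R) (f : B) : B :=
  expR (- t) *:
    limn (series (fun n : nat => (t ^+ n / n`!%:R) *: iter n L f)).

(* Only the restriction of u to [0, +oo[ matters; the derivative is one-sided
   at 0. *)
Definition has_deriv_ge0 (u u' : R -> B) := forall t : R, 0 <= t ->
  (s - t)^-1 *: (u s - u t) @[s --> within [set s | 0 <= s] t^'] --> u' t.

(* u' + u = Gamma(u) for t >= 0, u(0) = u0, with u in C^1([0, +oo[, B) *)
Definition cauchy_solution (Gamma : B -> B) (u0 : B) (u : R -> B) :=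
  exists u' : R -> B,
    [/\ has_deriv_ge0 u u',
        {within [set t | 0 <= t], continuous u'},
        forall t : R, 0 <= t -> u' t + u t = Gamma (u t)
      & u 0 = u0].

Definition unit_solution (Gamma : B -> B) (u0 : B) (u : R -> B) :=
  cauchy_solution Gamma u0 u /\ forall t : R, 0 <= t -> `|u t| <= 1.

End CauchyProblem.

Section Pointwise.
Context {R : realType} {X : topologicalType}.
Local Notation B := (bcfun R X).

Definition positive_op (L : B -> B) :=
  forall f : B, (forall x, 0 <= f x) -> forall x, 0 <= L f x.

Definition op_lipschitz_on (U : set B) (L Gamma : B -> B) :=
  forall u1 u2 : B, U u1 -> U u2 ->
    forall x, `|Gamma u1 x - Gamma u2 x| <= L (bcabs (u1 - u2)) x.

End Pointwise.

(* Main.v *)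
(** If [d = u - w] is the difference of two solutions then, at each point of
    the domain, [|d' + d| <= L|d|], and a real function [f] with
    [|f' + f| <= g' + g] and [|f 0| <= g 0] satisfies [|f| <= g].  Starting
    from [|d| <= 2], each use of this comparison adds one term of the
    exponential series of [L] to the majorant and halves the remainder,
    measured with the weight [e^(2Mt)], where [M] bounds the norm of [L].  The
    same weight makes the Picard map a contraction by [1/2] on 2-Lipschitz
    curves in the unit ball.  The linear equation [v' + v = h] in [C(X)] is
    solved separately at each point of [X], so no Banach-valued integral is
    needed; comparing the solutions at two points gives continuity on [X]. *)
Require Import Defs.
From HB Require Import structures.
From mathcomp Require Import all_boot all_order all_algebra.
From mathcomp Require Import all_classical all_reals all_analysis.
From mathcomp Require Import ring lra.

Set Implicit Arguments.
Unset Strict Implicit.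
Unset Printing Implicit Defensive.

Import Order.TTheory GRing.Theory Num.Theory.
Import numFieldNormedType.Exports.

Local Open Scope classical_set_scope.
Local Open Scope ring_scope.

(** * The scalar equation f' + f = h and its comparison principle *)

Section Relaxation.
Context {R : realType}.
Implicit Types f g h k : R -> R.

(** This encodes f' + f = h on the half-line. At 0 only one-sided continuity is asked, which is all
    that the mean value theorem on [0, T] uses. *)
Definition relaxes h f := {within [set t : R | 0 <= t], continuous f} /\
  forall t : R, 0 < t -> is_derive t 1 f (h t - f t).

Lemma is_derive_expRN (t : R) :
  is_derive t 1 (fun t : R => expR (- t)) (- expR (- t)).
Proof.
apply: (is_derive_eq (is_derive1_comp (is_derive_expR (- t)) (is_deriveNid t 1))).
by rewrite mulrN1.
Qed.

Lemma is_derive_relaxes h f :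
  (forall t : R, 0 <= t -> is_derive t 1 f (h t - f t)) -> relaxes h f.
Proof.
move=> df; split=> [|t /ltW]; last exact: df.
apply/continuous_in_subspaceT => t; rewrite inE/= => t0.
by apply/differentiable_continuous/derivable1_diffP; case: (df t t0).
Qed.

(** The integrating factor [expR t] gives (e^t f)' = e^t h, so by the mean value theorem e^T f(T) is
    f(0) plus a nonnegative term. *)
Lemma relaxes_ge0 h f T : 0 <= T -> relaxes h f ->
  (forall t, 0 < t -> t < T -> 0 <= h t) -> 0 <= f 0 -> 0 <= f T.
Proof.
rewrite le_eqVlt => /predU1P[<-//|T0] [cf df] h0 f0.
have [t tT||c cT] := @MVT R (fun t => expR t * f t)
  (fun t => expR t * h t) 0 T T0.
- have t0 : 0 < t by move: tT; rewrite in_itv/= => /andP[].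
  have := df _ t0 => dft.
  by apply: is_derive_eq; rewrite /GRing.scale/=; ring.
- move=> t; apply: cvgM; first exact/continuous_subspaceT/continuous_expR.
  apply: (continuous_subspaceW _ cf) => s /=.
  by rewrite in_itv/= => /andP[].
- rewrite expR0 mul1r subr0 => /eqP; rewrite subr_eq => /eqP e.
  rewrite -(pmulr_rge0 _ (expR_gt0 T)) e addr_ge0// mulr_ge0 ?(ltW T0)//.
  move: cT; rewrite in_itv/= => /andP[c0 cT].
  by rewrite mulr_ge0 ?expR_ge0 ?h0.
Qed.

Lemma relaxesD h k f g : relaxes h f -> relaxes k g ->
  relaxes (fun t => h t + k t) (fun t => f t + g t).
Proof.
move=> [cf df] [cg dg]; split=> [t|t t0].
  by apply: cvgD; [exact: cf|exact: cg].
have := df _ t0 => dft; have := dg _ t0 => dgt.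
by apply: is_derive_eq; ring.
Qed.

Lemma relaxesN h f : relaxes h f -> relaxes (fun t => - h t) (fun t => - f t).
Proof.
move=> [cf df]; split=> [t|t t0]; first by apply: cvgN; exact: cf.
have := df _ t0 => dft.
by apply: is_derive_eq; ring.
Qed.

Lemma relaxesB h k f g : relaxes h f -> relaxes k g ->
  relaxes (fun t => h t - k t) (fun t => f t - g t).
Proof. by move=> hf kg; exact/relaxesD/relaxesN. Qed.

(** Comparison principle: [g + f] and [g - f] both have nonnegative forcing and nonnegative initial
    value. *)
Lemma relaxes_le h k f g T : 0 <= T -> relaxes h f -> relaxes k g ->
  (forall t, 0 < t -> t < T -> `|h t| <= k t) -> `|f 0| <= g 0 -> `|f T| <= g T.
Proof.
move=> T0 hf kg hk; rewrite !ler_norml => /andP[fg0 gf0]; apply/andP; split.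
  rewrite lerNl -subr_ge0 opprK; apply: (relaxes_ge0 T0 (relaxesD kg hf)).
    by move=> t t0 tT; move: (hk t t0 tT); rewrite ler_norml; lra.
  by lra.
rewrite -subr_ge0; apply: (relaxes_ge0 T0 (relaxesB kg hf)).
  by move=> t t0 tT; move: (hk t t0 tT); rewrite ler_norml; lra.
by rewrite subr_ge0.
Qed.

Lemma relaxes_cst (c : R) : relaxes (cst c) (cst c).
Proof.
split=> [|t _]; first exact/continuous_subspaceT/cst_continuous.
by apply: is_derive_eq => /=; rewrite subrr.
Qed.

(** Supplies exponential majorants: with a = 2M the forcing carries the factor 2M + 1, and this is
    what makes each comparison gain a factor 1/2. *)
Lemma relaxes_expR (c a : R) : relaxes (fun t => c * (a + 1) * expR (a * t))
  (fun t => c * expR (a * t)).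
Proof.
have d (t : R) : is_derive t 1 (fun t => c * expR (a * t))
    (c * (a + 1) * expR (a * t) - c * expR (a * t)).
  have : is_derive t 1 (fun t => a * t) a.
    by apply: is_derive_eq; rewrite /GRing.scale/=; ring.
  move=> da; have := is_derive1_comp (is_derive_expR (a * t)) da.
  move=> /is_deriveZ-/(_ c) dd.
  by apply: (is_derive_eq dd); rewrite /GRing.scale/=; ring.
by apply: is_derive_relaxes => t _; exact: d.
Qed.

(* The primitive is taken from -1 so that it is differentiable at 0. *)
Lemma relaxes_exists h (a : R) : continuous h ->
  exists f, f 0 = a /\ relaxes h f.
Proof.
move=> ch; pose g t := expR t * h t.
have cg : continuous g by move=> t; apply: cvgM; [exact: continuous_expR|exact: ch].
pose F x := (\int[@lebesgue_measure R]_(t in `[-1, x]) (g t))%R.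
have dF (t : R) : -1 < t -> is_derive t 1 F (g t).
  move=> t1; have [] := @continuous_FTC1_closed R g (-1) t (t + 1) _ _ t1 (cg t).
  - by rewrite ltrDl.
  - apply: continuous_compact_integrable; first exact: segment_compact.
    exact: continuous_subspaceT.
  - by move=> dF F'; split; [exact: dF|rewrite -derive1E].
(* Variation of constants: a e^-t plus the integral over [0, t] of e^(s - t) h(s). *)
pose f t := expR (- t) * (a + (F t - F 0)).
have df (t : R) : 0 <= t -> is_derive t 1 f (h t - f t).
  move=> t0; have := dF t => /(_ _)[|dFt F't]; first lra.
  have dft : is_derive t 1 F (g t) by split.
  have dE := is_derive_expRN t.
  apply: is_derive_eq.
  rewrite /GRing.scale/= /f /g.
  have : expR (- t) * expR t = 1 by rewrite expRN mulVf// gt_eqF ?expR_gt0.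
  move: (expR (- t)) (expR t) => x y xy.
  by transitivity (x * y * h t - x * (a + (F t - F 0))); [ring|rewrite xy mul1r].
exists f; split; last exact: is_derive_relaxes.
by rewrite /f subrr addr0 oppr0 expR0 mul1r.
Qed.

End Relaxation.

(** * Change of representatives, and Lipschitz maps *)

Section RelaxationCongruence.
Context {R : realType}.

Lemma relaxes_eq (h k f g : R -> R) : (forall t, 0 < t -> h t = k t) ->
  (forall t, 0 <= t -> f t = g t) -> relaxes h f -> relaxes k g.
Proof.
move=> hk fg [cf df]; split=> [|t t0].
  by apply: subspace_eq_continuous cf => t; rewrite inE => /fg.
rewrite -hk// -fg ?ltW//; apply: near_eq_is_derive (df t t0).
by near=> s; apply/fg/ltW; near: s; exact: lt_nbhsr.
Unshelve. all: by end_near. Qed.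

Lemma near_dist_le (V : normedModType R) (a : V) (e : R) : 0 < e ->
  \forall b \near a, `|a - b| <= e.
Proof.
have /cvgrPdist_le : (b : V) @[b --> a] --> a by exact: cvg_id.
exact.
Qed.

Lemma lipschitz_continuous (V W : normedModType R) (f : V -> W) (K : R) :
  (forall a b, `|f a - f b| <= K * `|a - b|) -> continuous f.
Proof.
move=> fK a; apply/cvgrPdist_le => e e0.
(* The sign of [K] is not prescribed, so a positive constant above it is used as divisor. *)
have K0 : 0 < `|K| + 1 by rewrite ltr_wpDl.
near=> b; apply: (le_trans (fK a b)).
apply: (@le_trans _ _ ((`|K| + 1) * `|a - b|)).
  by rewrite ler_wpM2r// (le_trans (ler_norm K))// lerDl.
rewrite -ler_pdivlMl//; near: b; apply: cvgr_dist_le; first exact: cvg_id.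
by rewrite mulr_gt0 ?invr_gt0.
Unshelve. all: by end_near. Qed.

(** Curves on the half-line are extended to negative times by their value at 0; this shows that the
    extension keeps the Lipschitz constant. *)
Lemma ler_dist_max0 (s t : R) : `|Num.max s 0 - Num.max t 0| <= `|s - t|.
Proof.
have [s0|/ltW s0] := lerP 0 s; have [t0|/ltW t0] := lerP 0 t.
- by [].
- by rewrite subr0 !ger0_norm//; lra.
- by rewrite sub0r normrN ger0_norm// ler0_norm; lra.
- by rewrite subrr normr0.
Qed.

End RelaxationCongruence.

(** * Curves in C(X) and their evaluations at points *)

Section Curves.
Context {R : realType} {X : topologicalType}.
Local Notation B := (bcfun R X).

(** Evaluation at [x] is linear and bounded by the sup norm, so norm convergence of difference
    quotients passes to the values at [x]. *)
Lemma has_deriv_ge0_eval (u u' : R -> B) (x : X) : has_deriv_ge0 u u' ->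
  relaxes (fun t => u' t x + u t x) (fun t => u t x).
Proof.
move=> du; have qE (t s : R) : u' t x - (s - t)^-1 * (u s x - u t x) =
    (u' t - (s - t)^-1 *: (u s - u t)) x by [].
split=> [|t t0].
  apply/subspace_continuousP => t /= t0; apply/cvgrPdist_le => e e0.
  (* Continuity, also at 0: once the quotient is within 1 of [u' t], its norm is at most |u'(t)| +
     1, and u(t) - u(s) is at most |t - s| times that. *)
  have /cvgrPdist_le/(_ 1 ltr01) := du t t0.
  move=> /= du1.
  have K0 : 0 < `|u' t| + 1 by rewrite ltr_wpDl.
  have te : \forall s \near t, `|t - s| <= (`|u' t| + 1)^-1 * e.
    by apply: near_dist_le; rewrite mulr_gt0 ?invr_gt0.
  have {}du1 : \forall s \near t, s != t -> 0 <= s ->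
    `|u' t - (s - t)^-1 *: (u s - u t)| <= 1 by exact: du1.
  suff : \forall s \near t, 0 <= s -> `|u t x - u s x| <= e by [].
  move: du1 te; apply: filterS2 => s + st s0.
  have [->|sNt /(_ isT s0)] := eqVneq s t.
    by move=> _; rewrite subrr normr0 ltW.
  set q := (s - t)^-1 *: _ => q1.
  have -> : u t x - u s x = (t - s) * (q : B) x.
    have st0 : s - t != 0 by rewrite subr_eq0.
    rewrite [q x]/((s - t)^-1 * (u s x - u t x)).
    by rewrite -(opprB s t) mulNr mulrA divff// mul1r opprB.
  rewrite normrM (le_trans (ler_wpM2l _ (le_sup_norm q x)))//.
  apply: (@le_trans _ _ (`|t - s| * (`|u' t| + 1))); last first.
    by rewrite mulrC -ler_pdivlMl.
  rewrite ler_wpM2l//.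
  have -> : sup_norm q = `|u' t - (u' t - q)| by rewrite subKr.
  by rewrite (le_trans (ler_normB _ _))// lerD2l.
rewrite addrK; have ct : (s + t) @[s --> (0 : R)] --> t.
  by rewrite -[X in _ --> X]add0r; apply: cvgD; [exact: cvg_id|exact: cvg_cst].
have dx : h^-1 *: (((u^~ x) \o shift t) (h *: 1) - u t x) @[h --> 0^'] --> u' t x.
  apply/cvgrPdist_le => e e0.
  have /cvgrPdist_le/(_ e e0) := du t (ltW t0).
  move=> du1; have {}du1 : \forall s \near t, s != t -> 0 <= s ->
    `|u' t - (s - t)^-1 *: (u s - u t)| <= e by exact: du1.
  have {}du1 : \forall h \near (0 : R), h + t != t -> 0 <= h + t ->
    `|u' t - (h + t - t)^-1 *: (u (h + t) - u t)| <= e by exact: (ct _ du1).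
  suff : \forall h \near (0 : R), h != 0 ->
    `|u' t x - h^-1 *: (((u^~ x) \o shift t) (h *: 1) - u t x)| <= e by [].
  (* For t > 0 the times t + h are positive for small h, so the one-sided quotient is a two-sided
     one. *)
  have tgt0 : \forall h \near (0 : R), 0 < h + t by exact: (ct _ (lt_nbhsr t0)).
  move: tgt0 du1; apply: filterS2 => h /= ht0 du1 hN0.
  move: du1; rewrite -subr_eq0 addrK => /(_ hN0 (ltW ht0)) du1.
  rewrite (_ : h *: 1 = h); last exact: mulr1.
  exact: le_trans (le_sup_norm (_ - _) x) du1.
by split; [apply/cvg_ex; exists (u' t x)|exact: cvg_lim].
Unshelve. all: by end_near. Qed.

Lemma bcfun_scaleE (a : R) (f : B) x : (a *: f) x = a * f x.
Proof. by []. Qed.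

Lemma bcfunD (f g : B) x : (f + g) x = f x + g x.
Proof. by []. Qed.

Lemma bcfun_norm_le (f : B) M : 0 <= M -> (forall x, `|f x| <= M) -> `|f| <= M.
Proof. exact: sup_norm_le. Qed.

Lemma bcfun_le_norm (f : B) x : `|f x| <= `|f|.
Proof. exact: le_sup_norm. Qed.

(** The equation is solved at each point separately. Comparison with the constant 1 bounds the
    solution, and since v' = h - v has absolute value at most 2, the mean value theorem gives the
    Lipschitz constant 2. *)
Lemma relaxation_curve (h : R -> B) (u0 : B) (K : R) :
  (forall s t, `|h s - h t| <= K * `|s - t|) -> (forall t, `|h t| <= 1) ->
  `|u0| <= 1 ->
  exists v : R -> B, [/\ v 0 = u0, forall t, `|v t| <= 1,
    forall s t, `|v s - v t| <= 2 * `|s - t| &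
    forall x, relaxes (fun t => h t x) (fun t => v t x)].
Proof.
move=> hK h1 u01.
have ch := lipschitz_continuous hK.
have chx x : continuous (fun t => h t x).
  apply: (@lipschitz_continuous _ _ _ _ K) => s t.
  by rewrite -bcfunB (le_trans (bcfun_le_norm _ _)).
have /choice[phi phiP] x := relaxes_exists (u0 x) (chx x).
have phi0 x : phi x 0 = u0 x by case: (phiP x).
have {}phiP x : relaxes (fun t => h t x) (phi x) by case: (phiP x).
have phi1 t x : 0 <= t -> `|phi x t| <= 1.
  move=> t0; apply: (relaxes_le t0 (phiP x) (relaxes_cst 1)) => [s _ _|].
    by rewrite (le_trans (bcfun_le_norm _ _)).
  by rewrite phi0 (le_trans (bcfun_le_norm _ _)).
have phibc t : 0 <= t -> (phi^~ t : X -> R) \in bounded_continuous.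
  move=> t0; apply/bounded_continuousP; split; last by exists 1 => x; exact: phi1.
  move=> x; apply/cvgrPdist_le => e e0.
  (* Compactness of [0, t] makes the continuity of [h s] at [x] uniform in s. The difference of the
     solutions at [x] and [y] is then compared with the constant solution [e]. *)
  have hx : \forall y \near x, `[0, t] `<=` (fun s => `|h s x - h s y| <= e).
    apply: (compact_near_coveringP _).1; first exact: segment_compact.
    move=> s _; have e30 : 0 < e / 3 by rewrite divr_gt0.
    have hs : \forall r \near s, `|h s - h r| <= e / 3.
      by have /cvgrPdist_le := ch s; exact.
    have hy : \forall y \near x, `|h s x - h s y| <= e / 3.
      by have /cvgrPdist_le := @bcfun_continuous _ _ (h s) x; exact.
    near=> r y.
    have hsr : `|h s - h r| <= e / 3 by near: r.
    have hsy : `|h s x - h s y| <= e / 3 by near: y.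
    have := le_trans (bcfun_le_norm _ x) hsr.
    have := le_trans (bcfun_le_norm _ y) hsr.
    by rewrite !bcfunB; move: hsy; rewrite !ler_norml; lra.
  near=> y.
  apply: (relaxes_le t0 (relaxesB (phiP x) (phiP y)) (relaxes_cst e)).
    move=> s s0 st; have : `[0, t] `<=` (fun s => `|h s x - h s y| <= e).
      by near: y.
    by apply; rewrite /= in_itv/= !ltW.
  rewrite !phi0; near: y.
  by have /cvgrPdist_le := @bcfun_continuous _ _ u0 x; exact.
have m0 (t : R) : 0 <= Num.max t 0 by rewrite le_max lexx orbT.
(* Negative times get the value at 0, so [v] is total and Lipschitz on the whole line. *)
pose v t : B := BCFun (phibc _ (m0 t)).
have relv x : relaxes (fun t => h t x) (fun t => v t x).
  by apply: relaxes_eq (phiP x) => // t t0 /=; rewrite max_l.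
have v1 t : `|v t| <= 1 by apply: bcfun_norm_le => // x; exact: phi1.
exists v; split=> //.
  by apply: bcfunP => x /=; rewrite maxxx phi0.
suff vP s t : 0 <= s -> s < t -> `|v s - v t| <= 2 * `|s - t|.
  have vE r : v r = v (Num.max r 0).
    by apply: bcfunP => x /=; rewrite -maxA maxxx.
  move=> s t; apply: (@le_trans _ _ (2 * `|Num.max s 0 - Num.max t 0|)).
    rewrite (vE s) (vE t).
    have [st|ts|->] := ltgtP (Num.max s 0) (Num.max t 0).
    - exact: vP.
    - by rewrite distrC (distrC (Num.max s 0)) vP.
    - by rewrite subrr normr0 mulr_ge0.
  by rewrite ler_wpM2l// ler_dist_max0.
move=> s0 st; apply: bcfun_norm_le => [|x]; first by rewrite mulr_ge0.
have [cv dv] := relv x.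
have [r||r rst e] := @MVT R (fun t => v t x) (fun t => h t x - v t x) s t st.
- by rewrite in_itv/= => /andP[sr _]; apply: dv; exact: le_lt_trans sr.
- apply: continuous_subspaceW cv => r /=.
  by rewrite in_itv/= => /andP[sr _]; exact: le_trans sr.
rewrite bcfunB distrC e normrM [X in _ <= _ * X]distrC ler_wpM2r//.
rewrite (le_trans (ler_normB _ _))// -[2]/(1 + 1) lerD//.
  exact: le_trans (bcfun_le_norm _ _) _.
exact: le_trans (bcfun_le_norm _ _) _.
Unshelve. all: by end_near. Qed.

End Curves.

(** * Partial sums of the exponential series as solutions *)

Section ExponentialSeries.
Context {R : realType}.

Lemma relaxes_expR_monomial (b : R) n :
  relaxes (fun t => expR (- t) * (t ^+ n / n`!%:R * b))
          (fun t => expR (- t) * (t ^+ n.+1 / n.+1`!%:R * b)).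
Proof.
have d (t : R) : is_derive t 1 (fun t => expR (- t) * (t ^+ n.+1 / n.+1`!%:R * b))
   (expR (- t) * (t ^+ n / n`!%:R * b) -
    expR (- t) * (t ^+ n.+1 / n.+1`!%:R * b)).
  have dE := is_derive_expRN t.
  have dX : is_derive t 1 (fun t : R => t ^+ n.+1) (n.+1%:R * t ^+ n).
    rewrite (_ : (fun t : R => t ^+ n.+1) = (id : R -> R) ^+ n.+1).
      apply: (is_derive_eq (is_deriveX n.+1 (is_derive_id t 1))).
      by rewrite /GRing.scale/= mulr1.
    by apply/funext => s; rewrite fctE.
  apply: is_derive_eq; rewrite /GRing.scale/=.
  have n0 : n`!%:R != 0 :> R by rewrite pnatr_eq0 -lt0n fact_gt0.
  have n1 : n.+1%:R != 0 :> R by rewrite pnatr_eq0.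
  rewrite factS natrM.
  field.
  by rewrite n0 addrC natr1 n1.
by apply: is_derive_relaxes => t _; exact: d.
Qed.

(** For a_k = (L^k r)(x) this says that the partial sums satisfy S_(n+1)' + S_(n+1) = L S_n at [x]:
    differentiating the series shifts the coefficients by one. *)
Lemma relaxes_expR_series (a : nat -> R) n :
  relaxes (fun t => expR (- t) * \sum_(0 <= k < n) t ^+ k / k`!%:R * a k.+1)
          (fun t => expR (- t) * \sum_(0 <= k < n.+1) t ^+ k / k`!%:R * a k).
Proof.
elim: n => [|n IH].
  (* With one term the solution is a_0 e^-t and the forcing is an empty sum. *)
  apply: relaxes_eq (relaxes_expR (a 0) (-1)) => t _.
    by rewrite addNr mulr0 mul0r big_geq// mulr0.
  by rewrite big_nat1 expr0 fact0 divr1 mul1r mulN1r mulrC.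
apply: relaxes_eq (relaxesD IH (relaxes_expR_monomial (a n.+1) n)) => t _.
  by rewrite [in RHS]big_nat_recr//= mulrDr.
by rewrite [in RHS]big_nat_recr//= mulrDr.
Qed.

Lemma norm_dist_lim_le (V : normedModType R) (f : nat -> V) (a l : V) (C : R) :
  f n @[n --> \oo] --> l -> (forall n, `|a - f n| <= C) -> `|a - l| <= C.
Proof.
move=> fl aC; apply/ler_addgt0Pr => e e0; near \oo => n.
rewrite (le_trans (ler_distD (f n) a l))// lerD// distrC.
by near: n; move: fl => /cvgrPdist_le/(_ e e0).
Unshelve. all: by end_near. Qed.

Lemma exists_geometric_lt (C e : R) : 0 < e -> exists n, C * 2^-1 ^+ n <= e.
Proof.
move=> e0; have : geometric C 2^-1 n @[n --> \oo] --> (0 : R).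
  by apply: cvg_geometric; rewrite ger0_norm ?invr_ge0// invf_lt1// ltr1n.
move=> /cvgrPdist_le/(_ e e0)[n _ /(_ n (leqnn n))].
by rewrite /= sub0r normrN => /(le_trans (ler_norm _)) ?; exists n.
Qed.

End ExponentialSeries.

(** * Pointwise evaluation, positive operators and convergence of the exponential *)

Section Evaluation.
Context {R : realType} {X : topologicalType}.
Local Notation B := (bcfun R X).

Lemma bcfun_cvg_eval (f : nat -> B) (l : B) x :
  f n @[n --> \oo] --> l -> f n x @[n --> \oo] --> l x.
Proof.
move=> /cvgrPdist_le fl; apply/cvgrPdist_le => e /fl; apply: filterS => n.
exact/le_trans/(le_sup_norm (l - f n)).
Qed.

Lemma bcfun_sumE (f : nat -> B) n x :
  (\sum_(0 <= k < n) f k) x = \sum_(0 <= k < n) f k x.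
Proof.
elim: n => [|n IH]; first by rewrite !big_geq.
by rewrite !big_nat_recr//= -IH.
Qed.

Lemma bcabs_norm_le (f : B) : `|bcabs f| <= `|f|.
Proof.
by apply: bcfun_norm_le => // x; rewrite /= normr_id; exact: bcfun_le_norm.
Qed.

Lemma bcabs0 : bcabs (0 : B) = 0.
Proof. by apply: bcfunP => x /=; rewrite normr0. Qed.

Lemma cst_bounded_continuous (c : R) : (cst c : X -> R) \in bounded_continuous.
Proof.
apply/bounded_continuousP; split; first exact: cst_continuous.
by exists `|c|.
Qed.

Definition bccst c : B := BCFun (cst_bounded_continuous c).

(** Gives uniqueness: for equal initial data the majorant is the exponential applied to 0. *)
Lemma op_exp0 (L : {linear B -> B}) t : op_exp L t 0 = 0.
Proof.
rewrite /op_exp; set s := series _.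
have -> : s = cst 0.
  apply/funext => n; rewrite /s /series/= big1// => k _.
  have -> : iter k L 0 = 0 by elim: k => //= k ->; rewrite linear0.
  exact: scaler0.
by rewrite lim_cst// scaler0.
Qed.

Section BoundedPositive.
Variables (L : {linear B -> B}) (M : R).
Hypotheses (M0 : 0 <= M) (LM : forall f, `|L f| <= M * `|f|).
Hypothesis L_positive : positive_op L.

Lemma positive_op_le (f g : B) :
  (forall x, f x <= g x) -> forall x, L f x <= L g x.
Proof.
move=> fg x; rewrite -subr_ge0 -bcfunB -linearB; apply: L_positive => y.
by rewrite bcfunB subr_ge0.
Qed.

Lemma positive_op_cst_le x : L (bccst 1) x <= M.
Proof.
rewrite (le_trans (ler_norm _))// (le_trans (bcfun_le_norm _ _))//.
rewrite (le_trans (LM _))// ler_piMr//.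
by apply: bcfun_norm_le => // y; rewrite /= normr1.
Qed.

Lemma iter_op_norm_le n f : `|iter n L f| <= M ^+ n * `|f|.
Proof.
elim: n => [|n IH]; first by rewrite mul1r.
by rewrite iterS exprS -mulrA (le_trans (LM _))// ler_wpM2l.
Qed.

(** The series converges absolutely, its terms being dominated in norm by those of |f| e^(tM), and
    C(X) is complete. *)
Lemma op_exp_cvg t f : 0 <= t ->
  expR (- t) *: series (fun n => (t ^+ n / n`!%:R) *: iter n L f) n
    @[n --> \oo] --> op_exp L t f.
Proof.
move=> t0; apply: cvgZl_tmp; apply: normed_cvg.
apply: (@series_le_cvg _ _ (fun n => `|f| * exp_coeff (t * M) n)) => [n|n|n|].
- exact: normr_ge0.
- by rewrite mulr_ge0// exp_coeff_ge0// mulr_ge0.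
- rewrite /= normrZ ger0_norm ?divr_ge0 ?exprn_ge0// /exp_coeff/= exprMn.
  rewrite (le_trans (ler_wpM2l _ (iter_op_norm_le n f))) ?divr_ge0 ?exprn_ge0//.
  by rewrite le_eqVlt; apply/orP; left; apply/eqP; ring.
- have := @is_cvg_seriesZ _ _ `|f| (is_cvg_series_exp_coeff (t * M)).
  exact.
Qed.

End BoundedPositive.
End Evaluation.

(** * The nonlinear problem under the L-Lipschitz condition *)

Section LipschitzCauchyProblem.
Context {R : realType} {X : topologicalType}.
Local Notation B := (bcfun R X).
Variables (Gamma : B -> B) (L : {linear B -> B}) (M : R).
Hypotheses (M0 : 0 <= M) (LM : forall f, `|L f| <= M * `|f|).
Hypothesis Gamma_ball : forall u, closed_unit_ball u -> closed_unit_ball (Gamma u).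
Hypothesis L_positive : positive_op L.
Hypothesis Gamma_lip : op_lipschitz_on closed_unit_ball L Gamma.

Lemma Gamma_norm_lip (u w : B) : `|u| <= 1 -> `|w| <= 1 ->
  `|Gamma u - Gamma w| <= M * `|u - w|.
Proof.
move=> u1 w1; apply: bcfun_norm_le => [|x]; first by rewrite mulr_ge0.
rewrite bcfunB (le_trans (Gamma_lip u1 w1 x))// (le_trans (ler_norm _))//.
rewrite (le_trans (bcfun_le_norm _ _))// (le_trans (LM _))//.
by rewrite ler_wpM2l// bcabs_norm_le.
Qed.

(** * Comparison of two solutions *)

Section Comparison.
Variables (u0 w0 : B) (u w : R -> B).
Hypotheses (u1 : forall t : R, 0 <= t -> `|u t| <= 1)
           (w1 : forall t : R, 0 <= t -> `|w t| <= 1)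
           (uE : u 0 = u0) (wE : w 0 = w0)
  (u_relax : forall x, relaxes (fun t => Gamma (u t) x) (fun t => u t x))
  (w_relax : forall x, relaxes (fun t => Gamma (w t) x) (fun t => w t x)).

Let r0 := bcabs (u0 - w0).
Let S n t : B :=
  expR (- t) *: series (fun k => (t ^+ k / k`!%:R) *: iter k L r0) n.

Let SE n t x :
  S n t x = expR (- t) * \sum_(0 <= k < n) t ^+ k / k`!%:R * iter k L r0 x.
Proof. by rewrite bcfun_scaleE bcfun_sumE. Qed.

Let LSE n t x :
  L (S n t) x = expR (- t) * \sum_(0 <= k < n) t ^+ k / k`!%:R * iter k.+1 L r0 x.
Proof.
rewrite linearZ linear_sum bcfun_scaleE bcfun_sumE; congr (_ * _).
by apply: eq_bigr => k _; rewrite linearZ.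
Qed.

(** Induction on the number of terms: a bound on |u - w| is carried through L to bound the forcing
    of u - w, and comparison turns this into a better bound on |u - w|. *)
Lemma dist_le_partial_op_exp n t x : 0 <= t ->
  `|u t x - w t x| <= S n t x + 2 * 2^-1 ^+ n * expR (2 * M * t).
Proof.
elim: n t x => [|n IH] t x t0.
  (* [S 0] vanishes, and two curves in the unit ball are at distance at most 2, hence at most 2
     e^(2Mt). *)
  rewrite SE big_geq// mulr0 add0r mulr1 -bcfunB (le_trans (bcfun_le_norm _ _))//.
  rewrite (le_trans (ler_normB _ _))//.
  have := expR_ge1Dx (2 * M * t); have := u1 t0; have := w1 t0.
  have : 0 <= 2 * M * t by rewrite !mulr_ge0.
  by lra.
have S_relax : relaxes (fun s => L (S n s) x) (fun s => S n.+1 s x).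
  apply: relaxes_eq (relaxes_expR_series (fun k => iter k L r0 x) n) => s _.
    by rewrite LSE.
  by rewrite SE.
(* With c = 2 / 2^(n+1), the new remainder c e^(2Mt) has forcing c (2M + 1) e^(2Mt), which exceeds
   the bound M (2c) e^(2Mt) for L of the old remainder. *)
apply: (relaxes_le t0 (relaxesB (u_relax x) (w_relax x))
  (relaxesD S_relax (relaxes_expR (2 * 2^-1 ^+ n.+1) (2 * M)))).
- move=> s s0 _; have {}s0 := ltW s0.
  rewrite (le_trans (Gamma_lip (u1 s0) (w1 s0) x))//.
  set E := expR _; have E0 : 0 <= 2^-1 ^+ n * E.
    by rewrite mulr_ge0 ?expR_ge0// exprn_ge0// invr_ge0.
  (* Positivity carries the induction hypothesis, valid at every point of the domain, through
     [L]. *)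
  have := @positive_op_le _ _ _ L_positive (bcabs (u s - w s))
    (S n s + (2 * 2^-1 ^+ n * E) *: bccst 1) _ x.
  move=> /(_ _)/le_trans; apply.
    by move=> y; rewrite [leRHS]bcfunD [X in _ <= _ + X]mulr1; exact: IH.
  rewrite linearD bcfunD lerD2l linearZ bcfun_scaleE exprS.
  have := positive_op_cst_le M0 LM x => L1.
  apply: (le_trans (ler_wpM2l _ L1)); first by rewrite -mulrA mulr_ge0.
  by move: (2^-1 ^+ n) E0 => q E0; nra.
(* At time 0 only the term k = 0 survives, and it equals |u0 - w0|. *)
- rewrite uE wE SE big_nat_recl// oppr0 expR0 mul1r expr0 fact0 divr1 mul1r.
  rewrite big1 => [|k _]; last by rewrite exprS !mul0r.
  by rewrite addr0 lerDl !mulr_ge0 ?expR_ge0 ?exprn_ge0 ?invr_ge0.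
Qed.

(** The number of terms tends to infinity with t fixed, so the weight e^(2Mt) is a constant and the
    remainder tends to 0. *)
Lemma dist_le_op_exp t x : 0 <= t -> `|u t x - w t x| <= op_exp L t r0 x.
Proof.
move=> t0; have /bcfun_cvg_eval-/(_ x) := @op_exp_cvg _ _ L M M0 LM t r0 t0.
move=> /cvgrPdist_le Scvg; apply/ler_addgt0Pr => e e0.
have e20 : 0 < e / 2 by rewrite divr_gt0.
have [N NE] := exists_geometric_lt (2 * expR (2 * M * t)) e20.
near \oo => n.
have Sn : `|op_exp L t r0 x - S n t x| <= e / 2 by near: n; exact: Scvg.
have qn : 2 * expR (2 * M * t) * 2^-1 ^+ n <= e / 2.
  apply: le_trans NE; rewrite ler_wpM2l ?mulr_ge0 ?expR_ge0//.
  rewrite ler_wiXn2l ?invr_ge0 ?invf_le1 ?ler1n//.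
  by near: n; exact: nbhs_infty_ge.
rewrite (le_trans (dist_le_partial_op_exp n x t0))//.
rewrite -/(S n t) [2 * _ * expR _]mulrAC.
move: Sn qn; rewrite ler_norml.
by move: (S n t x) (op_exp L t r0 x) (_ * 2^-1 ^+ n) => a b c; lra.
Unshelve. all: by end_near. Qed.

End Comparison.

(** * Existence by Picard iteration *)

Section Existence.
Variable u0 : B.
Hypothesis u01 : `|u0| <= 1.

(** The class on which the iteration acts: the Lipschitz bound makes [Gamma (u t)] Lipschitz in t,
    as [relaxation_curve] requires, and that lemma returns the same constant 2. *)
Let admissible (u : R -> B) := (forall t, `|u t| <= 1) /\
  (forall s t, `|u s - u t| <= 2 * `|s - t|).

Let picard_step (u v : R -> B) := [/\ admissible v, v 0 = u0 &
  forall x, relaxes (fun t => Gamma (u t) x) (fun t => v t x)].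

Let Gamma_curve_lip u : admissible u ->
  forall s t, `|Gamma (u s) - Gamma (u t)| <= M * 2 * `|s - t|.
Proof.
move=> [u1 u2] s t; rewrite (le_trans (Gamma_norm_lip (u1 s) (u1 t)))//.
by rewrite -mulrA ler_wpM2l.
Qed.

(** Admissibility sits under the existential so that choice yields a total Picard map; other curves
    get a dummy value. *)
Let picard_step_exists u : exists v, admissible u -> picard_step u v.
Proof.
have [au|nau] := pselect (admissible u); last by exists u.
have [t|v [v0 v1 v2 vrel]] := relaxation_curve (Gamma_curve_lip au) _ u01.
  by apply: Gamma_ball; exact: au.1.
by exists v.
Qed.

(** The majorant (c/2) e^(2Mt) has forcing (c/2)(2M + 1) e^(2Mt), at least the bound M c e^(2Mt) on
    the difference of the two forcings. *)
Let picard_contraction u w v z c : 0 <= c -> admissible u -> admissible w ->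
  picard_step u v -> picard_step w z ->
  (forall t, 0 <= t -> `|u t - w t| <= c * expR (2 * M * t)) ->
  forall t, 0 <= t -> `|v t - z t| <= c / 2 * expR (2 * M * t).
Proof.
move=> c0 [u1 _] [w1 _] [_ v0 vrel] [_ z0 zrel] uw t t0.
apply: bcfun_norm_le => [|x]; first by rewrite mulr_ge0 ?divr_ge0 ?expR_ge0.
rewrite bcfunB.
apply: (relaxes_le t0 (relaxesB (vrel x) (zrel x)) (relaxes_expR _ _)).
  move=> s s0 _; rewrite -bcfunB (le_trans (bcfun_le_norm _ _))//.
  rewrite (le_trans (Gamma_norm_lip (u1 s) (w1 s)))//.
  rewrite (le_trans (ler_wpM2l M0 (uw s (ltW s0))))//.
  by have := expR_ge0 (2 * M * s); move: (expR _) => E E0; nra.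
by rewrite v0 z0 subrr normr0 mulr_ge0 ?divr_ge0 ?expR_ge0.
Qed.

Lemma picard_fixpoint : exists u, [/\ forall t, `|u t| <= 1,
  forall s t, `|u s - u t| <= 2 * `|s - t|, u 0 = u0 &
  forall x, relaxes (fun t => Gamma (u t) x) (fun t => u t x)].
Proof.
have [Phi PhiP] := choice picard_step_exists.
pose U n := iter n Phi (fun=> u0).
have admU n : admissible (U n).
  elim: n => [|n IH]; last by case: (PhiP _ IH).
  by split=> // s t; rewrite subrr normr0 mulr_ge0.
(* Contracting n times the distance between [U 0] and [U k], which is at most 2, gives a bound
   uniform in k. *)
have contrU n k t : 0 <= t ->
    `|U n t - U (n + k)%N t| <= 2 * 2^-1 ^+ n * expR (2 * M * t).
  elim: n t => [|n IH] t t0.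
    rewrite mulr1 (le_trans (ler_normB _ _))//.
    have := expR_ge1Dx (2 * M * t).
    have := (admU 0%N).1 t; have := (admU (0 + k)%N).1 t.
    have : 0 <= 2 * M * t by rewrite !mulr_ge0.
    by lra.
  rewrite exprSr mulrA; apply: picard_contraction IH _ t0.
  - by rewrite mulr_ge0// exprn_ge0// invr_ge0.
  - exact: admU.
  - exact: admU.
  - exact: PhiP.
  - exact: PhiP.
have cvgU t : 0 <= t -> cvgn (fun n => U n t).
  move=> t0; apply/cauchy_cvgP; apply: cauchy_exP => e e0.
  have e20 : 0 < e / 2 by rewrite divr_gt0.
  have [n ne] := exists_geometric_lt (2 * expR (2 * M * t)) e20.
  exists (U n t); exists n => // m /= nm; rewrite -ball_normE/=.
  rewrite -(subnKC nm) (le_lt_trans (contrU _ _ _ t0))//.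
  by rewrite mulrAC (le_lt_trans ne)// ltr_pdivrMr// ltr_pMr// ltr1n.
have m0 (t : R) : 0 <= Num.max t 0 by rewrite le_max lexx orbT.
pose W t := limn (fun n => U n (Num.max t 0)).
have UW t : U n (Num.max t 0) @[n --> \oo] --> W t by exact: cvgU.
have admW : admissible W.
  split=> [t|s t].
    rewrite -[W t]subr0 distrC.
    apply: norm_dist_lim_le (UW t) _ => n.
    by rewrite sub0r normrN; exact: (admU n).1.
  rewrite -[W s - W t]subr0 distrC.
  apply: norm_dist_lim_le (cvgB (UW s) (UW t)) _ => n.
  rewrite sub0r normrN (le_trans ((admU n).2 _ _))// ler_wpM2l//.
  exact: ler_dist_max0.
have UWle n t : 0 <= t -> `|U n t - W t| <= 2 * 2^-1 ^+ n * expR (2 * M * t).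
  move=> t0; have := UW t; rewrite max_l// => Ut.
  have : U (n + k)%N t @[k --> \oo] --> W t.
    rewrite (_ : (fun k => _) = (fun k => U (k + n)%N t)).
      by move: Ut; rewrite -(cvg_shiftn n).
    by apply/funext => k; rewrite addnC.
  by move=> /norm_dist_lim_le; apply => k; exact: contrU.
have [PW1 PW2 PW3] := PhiP _ admW.
(* Both [W] and [Phi W] are within 2^-n e^(2Mt) of the iterate [U n.+1], for every n. *)
have PW t : 0 <= t -> W t = Phi W t.
  move=> t0; apply/eqP; rewrite -subr_eq0 -normr_le0; apply/ler_addgt0Pr => e e0.
  have [n ne] := exists_geometric_lt (2 * expR (2 * M * t)) e0.
  have UP : `|U n.+1 t - Phi W t| <= 2 * 2^-1 ^+ n / 2 * expR (2 * M * t).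
    apply: (picard_contraction _ (admU n) admW (PhiP _ (admU n)) (PhiP _ admW)
      _ t0); first by rewrite mulr_ge0// exprn_ge0// invr_ge0.
    by move=> s s0; exact: UWle.
  rewrite add0r (le_trans (ler_distD (U n.+1 t) _ _))//.
  have := UWle n.+1 t t0; rewrite distrC.
  by move: UP ne; rewrite exprS; move: (2^-1 ^+ n) (expR _) => q E; lra.
(* [Phi W] is the witness because the Picard step gives its initial value and its equation;
   replacing [W] by it in the forcing only uses their equality for t >= 0. *)
exists (Phi W); split=> //; [exact: PW1.1|exact: PW1.2|move=> x].
apply: relaxes_eq (PW3 x) => // t t0.
by rewrite PW// ltW.
Qed.

(** The equation is known only point by point; a Lipschitz bound on u' = Gamma(u) - u in norm
    upgrades the pointwise derivatives to a derivative in C(X). *)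
Lemma picard_unit_solution : exists u, unit_solution Gamma u0 u.
Proof.
(* The constant [K] below adds 2M, for [Gamma (u t)], and 2, for [u]. *)
have [u [u1 u2 uE urel]] := picard_fixpoint.
pose K := M * 2 + 2.
have K0 : 0 < K by rewrite ltr_wpDl// mulr_ge0.
pose u' t := Gamma (u t) - u t.
have u'_lip s t : `|u' s - u' t| <= K * `|s - t|.
  rewrite /u' opprD addrACA -opprD (le_trans (ler_normD _ _))// mulrDl lerD//.
    exact: Gamma_curve_lip.
  by rewrite normrN.
have slope (s t : R) x : 0 <= s -> s < t -> exists2 c : R, s < c < t &
    u t x - u s x = u' c x * (t - s).
  move=> s0 st; have [cu du] := urel x.
  have [c||c cst ->] := @MVT R (fun t => u t x) (fun t => u' t x) s t st.
  - by rewrite in_itv/= => /andP[sc _]; apply: du; exact: le_lt_trans sc.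
  - apply: continuous_subspaceW cu => c /=.
    by rewrite in_itv/= => /andP[sc _]; exact: le_trans sc.
  - by exists c => //; move: cst; rewrite in_itv.
exists u; split=> //; exists u'; split=> //.
- move=> t t0; apply/cvgrPdist_le => e e0.
  have : \forall s \near t, `|t - s| <= K^-1 * e.
    by apply: near_dist_le; rewrite mulr_gt0 ?invr_gt0.
  suff : \forall s \near t, `|t - s| <= K^-1 * e -> s != t -> 0 <= s ->
      `|u' t - (s - t)^-1 *: (u s - u t)| <= e.
    by apply: filterS2 => s; apply.
  near=> s => st sNt s0; apply: bcfun_norm_le => [|x]; first exact: ltW.
  rewrite -[X in `|X|]/(u' t x - (s - t)^-1 * (u s x - u t x)).
  (* The mean value point c depends on [x], but it lies between s and t, so the error is at most K
     |t - s| uniformly in [x]. *)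
  have [c ct ->] : exists2 c : R, `|t - c| <= `|t - s| &
      (s - t)^-1 * (u s x - u t x) = u' c x.
    have [st'|ts|/eqP] := ltgtP s t; last by rewrite (negbTE sNt).
      have [c /andP[sc ct] e'] := slope s t x s0 st'.
      exists c; first by rewrite !ger0_norm; lra.
      rewrite -(opprB (u t x)) e' -mulrN opprB mulrCA mulVf ?mulr1//.
      by rewrite subr_eq0.
    have [c /andP[sc ct] e'] := slope t s x t0 ts.
    exists c; first by rewrite !ler0_norm; lra.
    by rewrite e' mulrCA mulVf ?mulr1// subr_eq0.
  rewrite -(bcfunB (u' t)) (le_trans (bcfun_le_norm _ _))//.
  rewrite (le_trans (u'_lip _ _))//.
  by rewrite -ler_pdivlMl// (le_trans ct).
- exact/continuous_subspaceT/lipschitz_continuous/u'_lip.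
- by move=> t t0; rewrite subrK.
Unshelve. all: by end_near. Qed.

End Existence.
End LipschitzCauchyProblem.

(** * From solutions in C(X) to pointwise equations, and the conclusion *)

Lemma unit_solution_relaxes {R : realType} {X : topologicalType}
    (Gamma : bcfun R X -> bcfun R X) u0 u x : unit_solution Gamma u0 u ->
  relaxes (fun t => Gamma (u t) x) (fun t => u t x).
Proof.
move=> [[u' [du _ u'E _]] _].
apply: relaxes_eq (has_deriv_ge0_eval x du) => // t /ltW t0.
by rewrite -bcfunD u'E.
Qed.

Theorem theorem5p2 (R : realType) (D : domain_kind)
  (Gamma : bcfun R (spatial_domain R D) -> bcfun R (spatial_domain R D))
  (L : {linear bcfun R (spatial_domain R D) -> bcfun R (spatial_domain R D)})
  (Gamma_ball : forall u, closed_unit_ball u -> closed_unit_ball (Gamma u))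
  (L_bounded : bounded_op L)
  (L_positive : positive_op L)
  (Gamma_lip : op_lipschitz_on closed_unit_ball L Gamma) :
  (forall u0, closed_unit_ball u0 ->
     exists u, unit_solution Gamma u0 u /\
       forall w, unit_solution Gamma u0 w -> forall t : R, 0 <= t -> w t = u t) /\
  (forall u0 w0, closed_unit_ball u0 -> closed_unit_ball w0 ->
     forall u w, unit_solution Gamma u0 u -> unit_solution Gamma w0 w ->
     forall t : R, 0 <= t -> forall x : spatial_domain R D,
       `|u t x - w t x| <= op_exp L t (bcabs (u0 - w0)) x).
Proof.
have [M0 M0L] := L_bounded; have [M M_ge0 LM] : exists2 M : R, 0 <= M &
    forall f, `|L f| <= M * `|f|.
  (* The given bound may be negative when the space is trivial; its absolute value is also a
     bound. *)
  exists `|M0| => // f; rewrite (le_trans (M0L f))// ler_wpM2r//.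
  exact: ler_norm.
have comparison u0 w0 u w : unit_solution Gamma u0 u ->
    unit_solution Gamma w0 w -> forall (t : R) x, 0 <= t ->
    `|u t x - w t x| <= op_exp L t (bcabs (u0 - w0)) x.
  move=> uS wS t x t0; have [[u' [_ _ _ uE]] u1] := uS.
  have [[w' [_ _ _ wE]] w1] := wS.
  apply: (dist_le_op_exp M_ge0 LM L_positive Gamma_lip u1 w1 uE wE _ _ x t0).
    by move=> y; exact: unit_solution_relaxes uS.
  by move=> y; exact: unit_solution_relaxes wS.
split=> [u0 u01|u0 w0 _ _ u w uS wS t t0 x]; last exact: comparison.
have [u uS] := picard_unit_solution M_ge0 LM Gamma_ball Gamma_lip u01.
(* Uniqueness is the comparison estimate with equal initial data. *)
exists u; split=> // w wS t t0; apply: bcfunP => x; apply/eqP.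
rewrite -subr_eq0 -normr_le0 (le_trans (comparison _ _ _ _ wS uS _ _ t0))//.
by rewrite subrr bcabs0 op_exp0.
Qed.
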